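(* Let $X$ be a nonempty set and $\tau$ a nonempty family of subsets of $X$. If $\alpha$ is an infinite ordinal and $\beta$ is a nonzero ordinal with $\beta\le|\alpha|$, then the following properties of $(X,\tau)$ are equivalent. (1) $[\beta,|\alpha|]$-compactness. (2) $[\beta,|\alpha|^+)$-compactness. (3) $[\beta,\alpha]$-compactness. In particular, if $\mu\le\lambda$ are infinite cardinals, then $[\mu,\lambda]$-compactness is equivalent to $[\mu,\lambda^+)$-compactness.
   Context: For a nonempty set $X$, a nonempty family $\tau$ of subsets of $X$ (not necessarily a topology) and nonzero ordinals $\alpha,\beta$, $(X,\tau)$ is $[\beta,\alpha]$-compact if, whenever $(O_\delta)_{\delta\in\alpha}$ is a sequence of members of $\tau$ (repetitions allowed) with $\bigcup_{\delta\in\alpha}O_\delta=X$, there is $H\subseteq\alpha$ of order type $<\beta$ (in the induced order) with $\bigcup_{\delta\in H}O_\delta=X$. $(X,\tau)$ is $[\beta,\alpha)$-compact if it is $[\beta,\alpha']$-compact for every nonzero $\alpha'<\alpha$. Cardinals are identified with initial ordinals, and $\lambda^+$ is the successor cardinal of $\lambda$. *)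

(* Defs.v *)
From mathcomp Require Import all_boot all_order.
From mathcomp Require Import wochoice all_classical.

Set Implicit Arguments.
Unset Strict Implicit.
Unset Printing Implicit Defensive.

Local Open Scope classical_set_scope.
Local Open Scope card_scope.

(* An ordinal is given by a well-ordered type, and is only considered up to
   order isomorphism: equality of ordinals is [oiso] below. The relation is the
   reflexive one, as in [wochoice.well_order]. *)
Record Ord := MkOrd {
  osort :> Type;
  oleq : rel osort;
  oleq_wo : well_order oleq }.

Section OrdOrder.
Variable a : Ord.
Implicit Types (x y z : a) (A : set a).

Lemma oleq_min A : A !=set0 -> exists2 x, A x & forall y, A y -> oleq x y.
Proof.
move=> [x0 Ax0]; have [|x [[xA xmin] _]] := oleq_wo (A := [pred x | x \in A]).
  by exists x0; apply: mem_set.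
exists x; first exact: set_mem xA.
by move=> y Ay; apply: xmin; apply: mem_set.
Qed.

Lemma oleqxx x : oleq x x.
Proof. by have [|y -> ->] := @oleq_min [set x]; first by exists x. Qed.

Lemma oleq_total x y : oleq x y || oleq y x.
Proof.
have [|z [->|->] zmin] := @oleq_min [set x; y]; first by exists x; left.
- by rewrite zmin //; right.
- by rewrite orbC zmin //; left.
Qed.

Lemma oleq_anti x y : oleq x y -> oleq y x -> x = y.
Proof.
move=> xy yx; pose A : {pred a} := [pred z | `[< z = x \/ z = y >]].
have [Ax Ay] : x \in A /\ y \in A by split; apply/asboolP; [left|right].
have Amin t : oleq t x -> oleq t y -> lower_bound (@oleq a) A t.
  by move=> tx ty u /asboolP[]->.
have [|z [_ zu]] := oleq_wo (A := A); first by exists x.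
have zx : z = x by apply: zu; split; [exact: Ax | apply: Amin (oleqxx x) xy].
by rewrite -zx; apply: zu; split; [exact: Ay | apply: Amin yx (oleqxx y)].
Qed.

Lemma oleq_trans y x z : oleq x y -> oleq y z -> oleq x z.
Proof.
move=> xy yz.
have [|t At tmin] := @oleq_min [set t | [\/ t = x, t = y | t = z]].
  by exists x; constructor 1.
have tx : oleq t x by apply: tmin; constructor 1.
have ty : oleq t y by apply: tmin; constructor 2.
have tz : oleq t z by apply: tmin; constructor 3.
case: At => tE; subst t => //; first by rewrite (oleq_anti xy tx).
by rewrite -(oleq_anti yz ty).
Qed.

Lemma oltNge x y : (oleq y x /\ y <> x) <-> ~~ oleq x y.
Proof.
split=> [[yx nyx]|nxy]; first by apply/negP => /(oleq_anti yx).
have := oleq_total x y; rewrite (negPf nxy) /= => yx; split=> // yxE.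
by move: nxy; rewrite yxE oleqxx.
Qed.

End OrdOrder.

Lemma well_order_sub (a : Ord) (H : set a) :
  well_order (fun u v : set_type H => oleq (val u) (val v)).
Proof.
move=> A [u0 Au0].
have [|_ [u Au <-] xmin] := @oleq_min a [set val u | u in [set u | u \in A]].
  by exists (val u0), u0.
exists u; split=> [|v [Av vmin]].
  by split=> // v Av; apply: xmin; exists v.
apply: val_inj; apply: oleq_anti; last exact: vmin.
by apply: xmin; exists v.
Qed.

(* The order type of [H] in the induced order. *)
Definition sub_ord (a : Ord) (H : set a) : Ord := MkOrd (@well_order_sub a H).

Definition below (a : Ord) (x : a) : set a := [set y | oleq y x /\ y <> x].

Definition oiso (a b : Ord) : Prop :=
  exists2 f : a -> b, bijective f & {mono f : x y / oleq x y >-> oleq x y}.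

Definition olt (a b : Ord) : Prop := exists x : b, oiso a (sub_ord (below x)).

Definition ole (a b : Ord) : Prop := olt a b \/ oiso a b.

Definition ononzero (a : Ord) : Prop := [set: a] !=set0.

Definition oinfinite (a : Ord) : Prop := infinite_set [set: a].

(* Cardinals are initial ordinals. *)
Definition cardinal (k : Ord) : Prop :=
  forall a : Ord, olt a k -> ~ ([set: a] #= [set: k]).


Lemma bij_card (T U : Type) (f : T -> U) : bijective f -> [set: T] #= [set: U].
Proof.
case=> g fK gK; apply/card_bijP.
exists (fun u => SigSub (mem_set (I : [set: U] (f (val u))))).
exists (fun u => SigSub (mem_set (I : [set: T] (g (val u))))) => u;
  by apply: val_inj; rewrite /= ?fK ?gK.
Qed.

Lemma card_sub_ord (a : Ord) (H : set a) : [set: sub_ord H] #= H.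
Proof. exact: card_setT. Qed.

Lemma oiso_card a b : oiso a b -> [set: a] #= [set: b].
Proof. by case=> f /bij_card. Qed.

Lemma olt_card a b : olt a b -> [set: a] #<= [set: b].
Proof.
move=> [x /oiso_card e]; rewrite (card_le_eql e).
by rewrite (card_le_eql (card_sub_ord _)); apply: card_leT.
Qed.

Lemma ole_card a b : ole a b -> [set: a] #<= [set: b].
Proof. by case=> [/olt_card//|/oiso_card/card_eqPle[]]. Qed.

Lemma olt_below_card (a : Ord) (x : a) (c : Ord) : olt c (sub_ord (below x)) ->
  exists2 y, ~~ oleq x y & [set: c] #= below y.
Proof.
move=> [y /oiso_card cy].
have /set_mem/oltNge yx := valP y.
exists (val y) => //; apply: card_eq_trans cy _.
apply: card_eq_trans (card_sub_ord _) _.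
have -> : below (val y) = val @` below y.
  apply/seteqP; split=> [z [zy nzy]|_ [z [zy nzy] <-]]; last first.
    by split=> // /val_inj.
  have zx : z \in below x.
    apply/mem_set/oltNge; apply/negP => xz; move/negP: yx; apply.
    exact: oleq_trans xz zy.
  by exists (SigSub zx) => //; split=> // zyE; apply: nzy; rewrite -zyE.
by apply/card_esym/inj_card_eq => u v _ _; apply: val_inj.
Qed.

Lemma card_of_ex (a : Ord) :
  exists k : Ord, cardinal k /\ [set: k] #= [set: a].
Proof.
have [ca|/existsNP[b /not_implyP[[x bx] /contrapT ba]]] := pselect (cardinal a).
  by exists a; split.
have [|y ya ymin] := @oleq_min a [set y | below y #= [set: a]].
  exists x; apply: card_eq_trans ba; apply: card_esym.
  exact: card_eq_trans (oiso_card bx) (card_sub_ord _).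
exists (sub_ord (below y)); split; last exact: card_eq_trans (card_sub_ord _) ya.
move=> c /olt_below_card[z /negP zy cz] cE; apply: zy; apply: ymin => /=.
apply: card_eq_trans (card_esym cz) _; apply: card_eq_trans cE _.
exact: card_eq_trans (card_sub_ord _) ya.
Qed.

Lemma oiso_of (a c : Ord) (r : a -> c -> Prop) :
    (forall x, exists u, r x u) -> (forall u, exists x, r x u) ->
    (forall x x' u u', r x u -> r x' u' -> oleq u u' = oleq x x') ->
  oiso a c.
Proof.
move=> /choice[f rf] /choice[g rg] mono_r; exists f => [|x y]; last exact: mono_r.
exists g => [x|u].
  by apply: oleq_anti; rewrite -(mono_r _ _ _ _ (rg _) (rf _))
    || rewrite -(mono_r _ _ _ _ (rf _) (rg _)); rewrite oleqxx.
by apply: oleq_anti; rewrite (mono_r _ _ _ _ (rf _) (rg _))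
    || rewrite (mono_r _ _ _ _ (rg _) (rf _)); rewrite oleqxx.
Qed.

Section Comparison.
Variables a b : Ord.

Inductive osim (x : a) (y : b) : Prop := OSim of
  (forall x', ~~ oleq x x' -> exists2 y', ~~ oleq y y' & osim x' y') &
  (forall y', ~~ oleq y y' -> exists2 x', ~~ oleq x x' & osim x' y').

Lemma oleq_ind (c : Ord) (P : c -> Prop) :
  (forall x, (forall x', ~~ oleq x x' -> P x') -> P x) -> forall x, P x.
Proof.
move=> IH x; apply: contrapT => nPx.
have [|y nPy ymin] := @oleq_min c [set y | ~ P y]; first by exists x.
apply: nPy; apply: IH => z /negP zy; apply: contrapT => /ymin/zy; apply.
Qed.

Lemma osimF x y y' : osim x y -> osim x y' -> y = y'.
Proof.
elim/oleq_ind: x y y' => x IH.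
suff H y y' : osim x y -> osim x y' -> oleq y y'.
  by move=> y y' xy xy'; apply: oleq_anti; apply: H.
move=> [_ yx] [xy' _]; apply/negPn/negP => /yx[x' x'x x'y'].
have [y'' /negP y''y' x'y''] := xy' _ x'x.
by apply: y''y'; rewrite (IH _ x'x _ _ x'y'' x'y') oleqxx.
Qed.

Lemma osimI x x' y : osim x y -> osim x' y -> x = x'.
Proof.
elim/oleq_ind: y x x' => y IH.
suff H x x' : osim x y -> osim x' y -> oleq x x'.
  by move=> x x' xy x'y; apply: oleq_anti; apply: H.
move=> [xy _] [_ yx']; apply/negPn/negP => /xy[y' y'y x'y'].
have [x'' /negP x''x' x''y'] := yx' _ y'y.
by apply: x''x'; rewrite (IH _ y'y _ _ x''y' x'y') oleqxx.
Qed.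

Lemma osim_mono x x' y y' : osim x y -> osim x' y' -> oleq y y' = oleq x x'.
Proof.
move=> xy x'y'; apply/idP/idP; apply: contraTT.
  case: xy => [xy _] /xy[y'' y''y x'y''].
  by rewrite (osimF x'y' x'y'').
case: xy => [_ yx] /yx[x'' x''x x''y'].
by rewrite (osimI x'y' x''y').
Qed.

Lemma osim_dom x x' : (exists y, osim x y) -> oleq x' x -> exists y, osim x' y.
Proof.
move=> [y xy] x'x; have [xx'|] := boolP (oleq x x').
  by exists y; rewrite (oleq_anti x'x xx').
by case: xy => xy _ /xy[y' _]; exists y'.
Qed.

Lemma osim_ran y y' : (exists x, osim x y) -> oleq y' y -> exists x, osim x y'.
Proof.
move=> [x xy] y'y; have [yy'|] := boolP (oleq y y').
  by exists x; rewrite (oleq_anti y'y yy').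
by case: xy => _ yx /yx[x' _]; exists x'.
Qed.

Lemma ole_or_olt : ole a b \/ olt b a.
Proof.
have [aD|/existsNP aD] := pselect (forall x, exists y, osim x y).
- left; have [bR|/existsNP bR] := pselect (forall y, exists x, osim x y).
    right; apply: (oiso_of aD bR) => x x' y y'; exact: osim_mono.
  have [|y ny ymin] := @oleq_min b [set y | ~ exists x, osim x y] => //.
  left; exists y; pose r x (u : sub_ord (below y)) := osim x (val u).
  apply: (@oiso_of a (sub_ord (below y)) r) => [x|[z zy]|x x' u u'].
  + have [z xz] := aD x; suff zy : z \in below y by exists (SigSub zy).
    apply/mem_set/oltNge/negP => yz; apply: ny.
    by apply: (osim_ran _ yz); exists x.
  + apply: contrapT => nz; have /set_mem/oltNge/negP := zy; apply.
    exact: ymin.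
  + exact: osim_mono.
have [|x nx xmin] := @oleq_min a [set x | ~ exists y, osim x y] => //.
have xD x' : ~~ oleq x x' -> exists y, osim x' y.
  by move=> /negP xx'; apply: contrapT => /xmin/xx'; apply.
have [bR|/existsNP bR] := pselect (forall y, exists x, osim x y).
- right; exists x; pose r y (u : sub_ord (below x)) := osim (val u) y.
  apply: (@oiso_of b (sub_ord (below x)) r) => [y|[z zx]|y y' u u' yu yu'].
  + have [z zy] := bR y; suff zx : z \in below x by exists (SigSub zx).
    apply/mem_set/oltNge/negP => xz; apply: nx.
    by apply: (osim_dom _ xz); exists y.
  + by apply: xD; apply/oltNge/set_mem.
  + exact/esym/osim_mono.
have [|y ny ymin] := @oleq_min b [set y | ~ exists x, osim x y] => //.
case: (nx); exists y; split=> [x' x'x|y' y'y].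
  have [y' x'y'] := xD _ x'x; exists y' => //; apply/negP => yy'; apply: ny.
  by apply: (osim_ran _ yy'); exists x'.
have [x' x'y'] : exists x, osim x y'.
  by apply: contrapT => /ymin; apply/negP.
exists x' => //; apply/negP => xx'; apply: nx.
by apply: (osim_dom _ xx'); exists y'.
Qed.

End Comparison.

Lemma bigger_ord (k : Ord) : exists p : Ord, ~ ([set: p] #<= [set: k]).
Proof.
have [r r_wo] := well_ordering_principle (set k).
exists (MkOrd r_wo) => /card_leP[f].
pose g (A : set k) : k := val (f (SigSub (mem_set (I : [set: set k] A)))).
have g_inj : injective g.
  move=> A B /val_inj fAB.
  have f_inj : injective f by move=> u v; apply: 'inj_f; exact: mem_set.
  by case/f_inj: fAB.
pose D := [set x | exists2 A, g A = x & ~ A x].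
have nD : ~ D (g D) by move=> /[dup] Dg [A /g_inj AD]; rewrite AD.
by apply: (nD); exists D.
Qed.

Lemma succ_card_ex (k : Ord) : exists k' : Ord,
  [/\ cardinal k', olt k k' & forall m, cardinal m -> olt k m -> ole k' m].
Proof.
suff [k' nk' k'min] : exists2 k' : Ord, ~ ([set: k'] #<= [set: k]) &
    forall c, olt c k' -> [set: c] #<= [set: k].
  exists k'; split.
  - by move=> c /k'min ck /card_eqPle[_ k'c]; apply: nk'; apply: card_le_trans ck.
  - by have [/ole_card|] := ole_or_olt k' k.
  - move=> m m_card km; have [//|mk'] := ole_or_olt k' m.
    case: (m_card _ km); apply/card_eqPle; split; first exact: olt_card.
    exact: k'min.
have [p pk] := bigger_ord k.
have [pmin|/existsNP[c /not_implyP[[x cx] ck]]] :=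
  pselect (forall c, olt c p -> [set: c] #<= [set: k]); first by exists p.
have [|y yk ymin] := @oleq_min p [set y | ~ (below y #<= [set: k])].
  exists x => /= xk; apply: ck.
  by rewrite (card_le_eql (oiso_card cx)) (card_le_eql (card_sub_ord _)).
exists (sub_ord (below y)); first by rewrite (card_le_eql (card_sub_ord _)).
move=> d /olt_below_card[z /negP zy dz]; apply: contrapT => dk; apply: zy.
by apply: ymin; rewrite /= -(card_le_eql dz).
Qed.

(* |a| and k^+ below are chosen ordinals; [card_ofP] and [succ_cardP] determine
   them up to [oiso]. *)
Definition card_of (a : Ord) : Ord := sval (cid (card_of_ex a)).

Lemma card_ofP (a : Ord) : cardinal (card_of a) /\ [set: card_of a] #= [set: a].
Proof. exact: svalP (cid (card_of_ex a)). Qed.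

Definition succ_card (k : Ord) : Ord := sval (cid (succ_card_ex k)).

Lemma succ_cardP (k : Ord) : [/\ cardinal (succ_card k), olt k (succ_card k) &
  forall m, cardinal m -> olt k m -> ole (succ_card k) m].
Proof. exact: svalP (cid (succ_card_ex k)). Qed.

(* [b, a]-compactness; [ord_compact_below] is [b, a)-compactness. *)
Definition ord_compact (X : Type) (tau : set (set X)) (b a : Ord) : Prop :=
  forall O : a -> set X, (forall d, tau (O d)) -> \bigcup_d O d = [set: X] ->
  exists H : set a, olt (sub_ord H) b /\ \bigcup_(d in H) O d = [set: X].

Definition ord_compact_below (X : Type) (tau : set (set X)) (b a : Ord) : Prop :=
  forall a' : Ord, ononzero a' -> olt a' a -> ord_compact tau b a'.

(* Main.v *)
Require Import Defs.
From mathcomp Require Import all_boot all_order.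
From mathcomp Require Import wochoice all_classical.
(* This gives the name sub_ord back to order types of subsets. *)
Import Defs.

Set Implicit Arguments.
Unset Strict Implicit.
Unset Printing Implicit Defensive.

(** Write k for |a|. The implications from (2) only say that k and a are
    nonzero ordinals below k^+, so the content lies in deducing (1) from (3)
    and (2) from (1).

    The first deduction is monotonicity of compactness in the length of the
    covers ([ord_compact_le]). A cover of length c <= a becomes one of length a
    when its first member is repeated from position c on. A subcover of the
    latter that uses some repetition has order type at least s + 1, where s is
    the type of its part before c; replacing all the repetitions by the first
    member gives a subcover of the original cover, of type at most
    1 + s <= s + 1.

    For the second one, a cover of length a' < k^+ is first reindexed by k,
    along a surjection that ignores the orders. Compactness gives a subcover
    indexed by a subset of k of order type < b <= k, hence of fewer than k
    elements because k is an initial ordinal. Its image K in a' may have an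
    order type that is not below b, but K still has fewer than k elements, so
    its order type is below k. By monotonicity the space is
    [b, type of K]-compact, and the cover indexed by K, now in the order of a',
    has a subcover of type < b ([ord_compact_succ_card]).

    Ordinals are compared throughout by order-reflecting maps, that is, by
    strictly increasing ones since the orders are total: a <= b exactly when
    such a map from a to b exists ([ole_reflecting], [reflecting_ole]). *)

Local Open Scope classical_set_scope.
Local Open Scope card_scope.

(** * Comparing ordinals by order-reflecting maps *)

Definition reflecting (a b : Ord) (f : a -> b) : Prop :=
  forall x y, oleq (f x) (f y) -> oleq x y.

(** At a least counterexample x one would have f x < x, hence
    f x <= f (f x), which reflects to x <= f x. *)
Lemma reflecting_ge (a : Ord) (f : a -> a) :
  reflecting f -> forall x, oleq x (f x).
Proof.
move=> fR x; elim/oleq_ind: x => x IH.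
apply/negPn/negP => fx; move/negP: (fx); apply; apply: fR; exact: IH.
Qed.

(** An initial segment embedding; initiality of the range is what will place
    all positions outside of it after those inside. *)
Lemma ole_initial (c a : Ord) : ole c a ->
  exists2 f : c -> a, {mono f : x y / oleq x y >-> oleq x y} &
    forall x y, oleq y (f x) -> exists z, f z = y.
Proof.
case=> [[w]|] [f [g fK gK] fM]; last first.
  by exists f => // x y _; exists (g y).
exists (fun x => val (f x)) => [x y|x y yfx]; first by rewrite -fM.
have yw : y \in below w.
  apply/mem_set/oltNge; apply/negP => wy.
  have /set_mem/oltNge/negP := valP (f x); apply; exact: oleq_trans wy yfx.
by exists (g (SigSub yw)); rewrite gK.
Qed.

Lemma olt_nreflecting (a b : Ord) (f : b -> a) : olt a b -> ~ reflecting f.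
Proof.
move=> [w [g _ gM]] fR.
have hR : reflecting (fun x => val (g (f x))).
  by move=> x y xy; apply: fR; rewrite -gM.
have /set_mem/oltNge/negP := valP (g (f w)); apply; exact: reflecting_ge hR w.
Qed.

Lemma reflecting_ole (a b : Ord) (f : a -> b) : reflecting f -> ole a b.
Proof. by move=> fR; have [//|/olt_nreflecting/(_ fR)] := ole_or_olt a b. Qed.

Lemma ole_reflecting (a b : Ord) :
  ole a b -> exists f : a -> b, reflecting f.
Proof. by case/ole_initial => f fM _; exists f => x y; rewrite fM. Qed.

Lemma ole_trans (a b c : Ord) : ole a b -> ole b c -> ole a c.
Proof.
move=> /ole_reflecting[f fR] /ole_reflecting[g gR].
by apply: (@reflecting_ole _ _ (g \o f)) => x y /gR/fR.
Qed.

Lemma ole_nlt (a b : Ord) : ole a b -> ~ olt b a.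
Proof. by case/ole_reflecting => f fR /olt_nreflecting/(_ fR). Qed.

Lemma ole_olt_trans (a b c : Ord) : ole a b -> olt b c -> olt a c.
Proof.
move=> ab bc; have [ca|//] := ole_or_olt c a.
by case: (ole_nlt (ole_trans ca ab)).
Qed.

Lemma olt_ole_trans (a b c : Ord) : olt a b -> ole b c -> olt a c.
Proof.
move=> ab bc; have [ca|//] := ole_or_olt c a.
by case: (ole_nlt (ole_trans bc ca)).
Qed.

(** Stated for a relation, because the comparison maps needed below are given
    by a choice (a preimage, a least element) that exists only over [A]. *)
Lemma ole_sub_ord (a b : Ord) (A : set a) (B : set b) (r : a -> b -> Prop) :
    (forall x, A x -> exists2 y, B y & r x y) ->
    (forall x x' y y', A x -> A x' -> r x y -> r x' y' ->
       oleq y y' -> oleq x x') ->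
  ole (sub_ord A) (sub_ord B).
Proof.
move=> rT rR.
have /choice[f rf] (u : sub_ord A) : exists v : sub_ord B, r (val u) (val v).
  have [y /mem_set By ry] := rT _ (set_mem (valP u)).
  by exists (SigSub By).
apply: (@reflecting_ole _ _ f) => u v; apply: rR => //; exact: set_mem (valP _).
Qed.

Lemma ole_image_homo (a b : Ord) (f : a -> b) (H : set a) :
  {homo f : x y / oleq x y >-> oleq x y} -> ole (sub_ord (f @` H)) (sub_ord H).
Proof.
move=> fH; apply: (@ole_sub_ord _ _ _ _ (fun y x => f x = y)).
  by move=> _ [x Hx <-]; exists x.
by move=> _ _ x x' _ _ <- <- /fH.
Qed.

(** * Initial ordinals *)

Lemma olt_cardinal (k c : Ord) :
  cardinal k -> olt c k <-> ~ ([set: k] #<= [set: c]).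
Proof.
move=> kC; split=> [ck kc|kc].
  by apply: (kC _ ck); apply/card_eqPle; split=> //; exact: olt_card.
by have [/ole_card|] := ole_or_olt k c.
Qed.

Lemma olt_succ_card (k c : Ord) :
  olt c (succ_card k) <-> [set: c] #<= [set: k].
Proof.
have [sC ks smin] := succ_cardP k; split=> [cs|ck]; last first.
  apply/(olt_cardinal _ sC) => sc; have /(olt_cardinal _ sC) := ks; apply.
  exact: card_le_trans sc ck.
have [mC /card_eqPle[mc cm]] := card_ofP c.
have [/ole_card mk|/(smin _ mC)/ole_card sm] := ole_or_olt (card_of c) k.
  exact: card_le_trans cm mk.
have /(olt_cardinal _ sC) := cs; case; exact: card_le_trans sm mc.
Qed.

Lemma ole_card_of (a : Ord) : ole (card_of a) a.
Proof.
have [kC /card_eqPle[ka _]] := card_ofP a.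
by have [//|/(olt_cardinal _ kC)] := ole_or_olt (card_of a) a; case.
Qed.

Lemma oinfinite_nonzero (a : Ord) : oinfinite a -> ononzero a.
Proof.
by move=> aI; apply: contrapT => /nonemptyPn a0; apply: aI; rewrite a0.
Qed.

Lemma ononzero_card_of (a : Ord) : ononzero a -> ononzero (card_of a).
Proof.
move=> [x _]; have [_ /card_eqPle[_ /card_leP[f]]] := card_ofP a.
by exists (val (f (SigSub (mem_set (I : [set: a] x))))).
Qed.

Lemma card_le_surjection (a k : Ord) : ononzero a -> [set: a] #<= [set: k] ->
  exists f : k -> a, forall x, exists y, f y = x.
Proof.
move=> [x0 _] /card_leP[f].
pose i x := val (f (SigSub (mem_set (I : [set: a] x)))).
have iI : injective i.
  move=> x y /val_inj fxy.
  have fI : injective f by move=> u v; apply: 'inj_f; exact: mem_set.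
  by case/fI: fxy.
have /choice[g gP] y : exists x, forall x', i x' = y -> x = x'.
  have [[x xy]|ny] := pselect (exists x, i x = y).
    by exists x => x'; rewrite -xy => /iI.
  by exists x0 => x' x'y; case: ny; exists x'.
by exists g => x; exists (i x); apply: gP.
Qed.

(** * Compactness *)

(** Composing a sequence of length c with p pads it to length a by its first
    member: p inverts the embedding of c as an initial segment of a, and sends
    all later positions to the least element of c. A set that meets these
    positions loses at least one point after the initial segment and gains at
    most one point at the start. *)
Lemma padding_map (c a : Ord) : ononzero c -> ole c a ->
  exists2 p : a -> c, (forall x, exists y, p y = x) &
    forall H : set a, ole (sub_ord (p @` H)) (sub_ord H).
Proof.
move=> /oleq_min[x0 _ x0min] /ole_initial[f fM fI].
have fR x y : f x = f y -> x = y.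
  by move=> fxy; apply: oleq_anti; rewrite -fM fxy oleqxx.
have /choice[p pP] y : exists x, f x = y \/ (x = x0 /\ forall z, f z <> y).
  have [[z zy]|ny] := pselect (exists z, f z = y); first by exists z; left.
  by exists x0; right; split=> // z zy; apply: ny; exists z.
exists p => [x|H].
  by exists (f x); case: (pP (f x)) => [/fR//|[_ /(_ x)]].
have [[h Hh hout]|Hin] := pselect (exists2 h, H h & forall z, f z <> h).
- (* The index x0 need not come from the initial segment. To make room for it,
     every x is sent to the next element of H after f x, which exists because
     h lies after the whole initial segment. *)
  pose next x := [set y | H y /\ ~~ oleq y (f x)].
  have nexth x : next x h.
    by split=> //; apply/negP => /fI[z]; apply: hout.
  apply: (@ole_sub_ord _ _ _ _
    (fun x y => next x y /\ forall y', next x y' -> oleq y y')).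
    move=> x _; have [|y yx ymin] := @oleq_min a (next x).
      by exists h; apply: nexth.
    by exists y => //; case: yx.
  move=> x x' y y' Ax Ax' [[_ yx] ymin] [[_ y'x'] y'min] yy'.
  apply/negPn/negP => nxx'.
  have fxH : H (f x).
    case: Ax nxx' => z Hz <- nzx'; case: (pP z) => [->//|[zx0 _]].
    by move: nzx'; rewrite zx0 x0min.
  have := y'min (f x); rewrite /next /= fM nxx' => /(_ (conj fxH isT)) y'fx.
  have yfx := oleq_trans yy' y'fx.
  by move: yx; rewrite yfx.
- apply: (@ole_sub_ord _ _ _ _ (fun x y => f x = y)) => [x [y Hy yx]|].
    exists (f x) => //; rewrite -yx; case: (pP y) => [->//|[_ yout]].
    by case: Hin; exists y.
  by move=> x x' _ _ _ _ <- <-; rewrite fM.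
Qed.

Lemma ord_cover_nonzero (X : Type) (a : Ord) (O : a -> set X) :
  [set: X] !=set0 -> \bigcup_d O d = [set: X] -> ononzero a.
Proof.
by move=> [z _] OX; have : [set: X] z by []; rewrite -OX => -[x]; exists x.
Qed.

Lemma bigcup_surjection (X T U : Type) (f : T -> U) (O : U -> set X) :
    (forall x, exists y, f y = x) -> \bigcup_x O x = [set: X] ->
  \bigcup_y O (f y) = [set: X].
Proof.
move=> fS OX; rewrite -subTset -OX => z [x _ Oxz].
by have [y yx] := fS x; exists y; rewrite ?yx.
Qed.

Section Compactness.
Variables (X : Type) (tau : set (set X)).
Hypothesis hX : [set: X] !=set0.

Lemma ord_compact_le (b c a : Ord) :
  ole c a -> ord_compact tau b a -> ord_compact tau b c.
Proof.
move=> ca aC O Otau OX.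
have [p pS pH] := padding_map (ord_cover_nonzero hX OX) ca.
have [//||H [Hb HX]] := aC (fun y => O (p y)); first exact: bigcup_surjection.
exists (p @` H); split; first exact: ole_olt_trans (pH H) Hb.
by rewrite bigcup_image.
Qed.

Lemma ord_compact_succ_card (b k : Ord) : cardinal k -> ole b k ->
  ord_compact tau b k -> ord_compact_below tau b (succ_card k).
Proof.
move=> kC bk kcomp a' a'0 /olt_succ_card a'k O Otau OX.
have [f fS] := card_le_surjection a'0 a'k.
have [//||H [Hb HX]] := kcomp (fun y => O (f y)).
  exact: bigcup_surjection.
pose K : Ord := sub_ord (f @` H).
have Kk : olt K k.
  apply/(olt_cardinal _ kC) => kK.
  have /(olt_cardinal _ kC) := olt_ole_trans Hb bk; apply.
  apply: card_le_trans kK _.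
  rewrite (card_le_eql (card_sub_ord _)) (card_le_eqr (card_sub_ord _)).
  exact: card_image_le.
have Kcomp : ord_compact tau b K by apply: ord_compact_le kcomp; left.
have [//||L [Lb LX]] := Kcomp (fun u => O (val u)).
  rewrite -subTset -HX => z [y Hy Oz].
  have fy : f y \in f @` H by apply/mem_set; exists y.
  by exists (SigSub fy).
exists ((fun u : K => val u) @` L); split; last by rewrite bigcup_image.
exact: ole_olt_trans (@ole_image_homo K a' (fun u => val u) L (fun _ _ => id)) Lb.
Qed.

Lemma ord_compact_succ_cardE (b k : Ord) :
    cardinal k -> ononzero k -> ole b k ->
  ord_compact tau b k <-> ord_compact_below tau b (succ_card k).
Proof.
move=> kC k0 bk; split; first exact: ord_compact_succ_card.
by apply=> //; have [] := succ_cardP k.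
Qed.

End Compactness.

Theorem corollary2p8 (X : Type) (tau : set (set X))
    (hX : [set: X] !=set0) (htau : tau !=set0) :
  (forall a b : Ord, oinfinite a -> ononzero b -> ole b (card_of a) ->
     (ord_compact tau b (card_of a) <->
        ord_compact_below tau b (succ_card (card_of a))) /\
     (ord_compact_below tau b (succ_card (card_of a)) <->
        ord_compact tau b a)) /\
  (forall m l : Ord, cardinal m -> oinfinite m -> cardinal l -> oinfinite l ->
     ole m l ->
     (ord_compact tau m l <-> ord_compact_below tau m (succ_card l))).
Proof.
split=> [a b /oinfinite_nonzero a0 _ bk|m l _ _ lC /oinfinite_nonzero l0 ml];
  last exact: ord_compact_succ_cardE.
have [kC /card_eqPle[_ ak]] := card_ofP a.
have k0 := ononzero_card_of a0.
split; [exact: ord_compact_succ_cardE | split=> [sC|aC]].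
  by apply: sC => //; apply/olt_succ_card.
apply: ord_compact_succ_card => //.
exact: ord_compact_le (ole_card_of a) aC.
Qed.
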